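(* Let $m,n\ge 3$ be integers with $mn$ even, and let $\Gamma$ be an Abelian group of order $mn$ with exponent $r$. If $2r\min\{f(m),f(n)\}<\operatorname{lcm}(m,n)$, then there does not exist a $\Gamma$-distance magic labeling of the Cartesian product $C_m\square C_n$.
   Context: For a positive integer $m$, $f(m)=m/4$ if $m\equiv 0\pmod 4$; $f(m)=m/2$ if $m\equiv 2\pmod 4$; and $f(m)=m$ if $m$ is odd. The exponent of a finite group $\Gamma$ is the smallest positive integer $r$ such that $ra=0$ for all $a\in\Gamma$. $C_k$ denotes the cycle on $k\ge 3$ vertices. The Cartesian product $G\square H$ of graphs $G,H$ has vertex set $V(G)\times V(H)$; $(g,h)$ and $(g',h')$ are adjacent iff either $g=g'$ and $h$ is adjacent to $h'$ in $H$, or $h=h'$ and $g$ is adjacent to $g'$ in $G$. For a finite simple graph $G=(V,E)$ and an Abelian group $\Gamma$ (written additively) with $|\Gamma|=|V|$, a $\Gamma$-distance magic labeling of $G$ is a bijection $\ell\colon V\to\Gamma$ for which there exists $\mu\in\Gamma$ such that $\sum_{u\in N(v)}\ell(u)=\mu$ for every $v\in V$, where $N(v)$ is the open neighborhood of $v$. *)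

(* Defs.v *)
From HB Require Import structures.
From mathcomp Require Import all_boot all_algebra all_fingroup all_solvable.
Set Implicit Arguments.
Unset Strict Implicit.
Unset Printing Implicit Defensive.
Import GRing.Theory.
Local Open Scope ring_scope.

Definition f (m : nat) : nat :=
  if (m %% 4 == 0)%N then (m %/ 4)%N
  else if (m %% 4 == 2)%N then (m %/ 2)%N
  else m.

(* Graphs are adjacency relations on a finite vertex type; [simple_graph]
   is what makes such a relation a simple graph. *)
Definition simple_graph (V : finType) (e : rel V) : Prop :=
  symmetric e /\ irreflexive e.

(* [ordS i] is i + 1 modulo k. The relation is the cycle graph for k >= 3. *)
Definition cycle_graph (k : nat) : rel 'I_k :=
  fun i j => (j == ordS i) || (i == ordS j).

Definition cartesian_product (V W : finType) (e : rel V) (e' : rel W) :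
    rel (V * W) :=
  fun x y => (x.1 == y.1) && e' x.2 y.2 || (x.2 == y.2) && e x.1 y.1.

Definition open_neighborhood (V : finType) (e : rel V) (v : V) : {set V} :=
  [set u | e v u].

(* The condition #|Gamma| = #|V| follows from the bijectivity of l. *)
Definition distance_magic_labeling (V : finType) (e : rel V)
    (Gamma : finZmodType) (l : V -> Gamma) : Prop :=
  bijective l /\
  exists mu : Gamma,
    forall v : V, \sum_(u in open_neighborhood e v) l u = mu.

Lemma cycle_graph_simple (k : nat) :
  (3 <= k)%N -> simple_graph (@cycle_graph k).
Proof.
move=> k3; split=> [i j|i]; first by rewrite /cycle_graph orbC.
rewrite /cycle_graph orbb; apply/negbTE/eqP => /(congr1 val) /=.
have := ltn_ord i; rewrite leq_eqVlt => /orP[/eqP ik|ik].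
  by rewrite ik modnn => i0; move: k3; rewrite -ik i0.
by rewrite modn_small // => /n_Sn.
Qed.

Lemma cycle_graph_degree (k : nat) (i : 'I_k) :
  (3 <= k)%N -> #|open_neighborhood (@cycle_graph k) i| = 2%N.
Proof.
move=> k3.
have -> : open_neighborhood (@cycle_graph k) i = [set ordS i; ord_pred i].
  apply/setP=> j; rewrite !inE /cycle_graph; congr (_ || _).
  by rewrite eq_sym (can2_eq (@ordSK k) (@ord_predK k)).
rewrite cards2; suff -> : ordS i != ord_pred i by [].
rewrite -(can2_eq (@ordSK k) (@ord_predK k)); apply/eqP=> /(congr1 val) /=.
have := ltn_ord i; rewrite leq_eqVlt => /orP[/eqP ik|ik].
  rewrite ik modnn modn_small; last exact: leq_trans k3.
  by move=> i1; move: k3; rewrite -ik -i1.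
rewrite (modn_small ik); move: ik; rewrite leq_eqVlt => /orP[/eqP ik|ik].
  by rewrite ik modnn => i0; move: k3; rewrite -ik -i0.
by rewrite modn_small // => E; have := leqnSn i.+1; rewrite E ltnn.
Qed.

Lemma cartesian_product_simple (V W : finType) (e : rel V) (e' : rel W) :
  simple_graph e -> simple_graph e' -> simple_graph (cartesian_product e e').
Proof.
move=> [se ie] [se' ie']; split=> [x y|x]; rewrite /cartesian_product.
  by rewrite (eq_sym x.1) (eq_sym x.2) se se'.
by rewrite ie ie' !andbF.
Qed.

(* The library defines [exponent] as an lcm of element orders, in the
   multiplicative group underlying Gamma; in additive terms it is the least
   positive r with r a = 0 for all a. *)
Lemma exponent_additiveP (Gamma : finZmodType) (r : nat) :
  r = exponent [set: Gamma] <->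
  [/\ (0 < r)%N, forall a : Gamma, a *+ r = 0
    & forall s : nat, (0 < s)%N -> (forall a : Gamma, a *+ s = 0) ->
      (r <= s)%N].
Proof.
have P n : (exponent [set: Gamma] %| n)%N <-> forall a : Gamma, a *+ n = 0.
  split=> [/exponentP h a|h]; first by rewrite -FinRing.zmodXgE h ?inE.
  by apply/exponentP=> a _; rewrite FinRing.zmodXgE h.
have e0 : (0 < exponent [set: Gamma])%N by exact: exponent_gt0.
split=> [->|[r0 /P er rmin]].
  by split=> // [|s s0 /P /dvdn_leq]; [apply/P | apply].
apply/eqP; rewrite eqn_leq (dvdn_leq r0 er) andbT.
by apply: rmin => //; apply/P.
Qed.

(* Main.v *)
Require Import Defs.
From mathcomp Require Import all_boot all_algebra all_fingroup all_solvable.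
From mathcomp Require Import zify.

(** Lift the labeling to a doubly periodic g on nat * nat and put
    d a b = g (a + 2) (b + 2) - g a b. Subtracting the magic condition at
    (a + 1, b + 1) from the one at (a + 2, b + 2) gives
    d (a + 1) b + d a (b + 1) = 0, so d is invariant under translation by
    (2, -2). If m or n divides 4p then (2p, 2p) + (2p, -2p) = (4p, 0), or
    (2p, 2p) - (2p, -2p) = (0, 4p), is a period, whence d has period (2p, 2p).
    Summing d along the diagonal over r such periods gives r times an element
    of Gamma, which is 0: so g (2rp) (2rp) = g 0 0, and injectivity forces
    lcm(m, n) to divide 2rp. The number p = min(f(m), f(n)) is of this kind. *)

Section NeighborhoodSums.

Import GRing.Theory.
Local Open Scope ring_scope.

Lemma sum_cycle_neighborhood (k : nat) (A : nmodType) (F : 'I_k -> A)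
    (i : 'I_k) :
  (3 <= k)%N ->
  \sum_(j in open_neighborhood (@cycle_graph k) i) F j =
  F (ordS i) + F (ord_pred i).
Proof.
move=> k3; have := cycle_graph_degree i k3.
have -> : open_neighborhood (@cycle_graph k) i = [set ordS i; ord_pred i].
  apply/setP=> j; rewrite !inE /cycle_graph; congr (_ || _).
  by rewrite eq_sym (can2_eq (@ordSK k) (@ord_predK k)).
(* Degree 2 forces the successor and the predecessor to be distinct. *)
rewrite cards2; case: eqP => // /eqP ne _.
by rewrite big_setU1 ?inE // big_set1.
Qed.

(** Irreflexivity of [e] keeps the two fibres disjoint: a common point would make [v] adjacent to
    itself. *)
Lemma sum_cartesian_product_neighborhood (V W : finType) (e : rel V)
    (e' : rel W) (A : nmodType) (F : V * W -> A) (v : V) (w : W) :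
  irreflexive e ->
  \sum_(u in open_neighborhood (cartesian_product e e') (v, w)) F u =
  \sum_(x in open_neighborhood e v) F (x, w) +
  \sum_(y in open_neighborhood e' w) F (v, y).
Proof.
move=> ie.
have -> : open_neighborhood (cartesian_product e e') (v, w) =
    [set (x, w) | x in open_neighborhood e v]
    :|: [set (v, y) | y in open_neighborhood e' w].
  apply/setP=> [[x y]]; rewrite !inE /cartesian_product /= orbC.
  congr (_ || _).
    apply/andP/imsetP => [[/eqP<- h]|[x' h [-> ->]]].
      by exists x; rewrite ?inE.
    by rewrite eqxx; move: h; rewrite inE.
  apply/andP/imsetP => [[/eqP<- h]|[y' h [-> ->]]].
    by exists y; rewrite ?inE.
  by rewrite eqxx; move: h; rewrite inE.
rewrite (eq_bigl _ _ (fun u => in_setU u _ _)) bigU /=; last first.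
  rewrite disjoint_subset; apply/subsetP => _ /imsetP[x + ->].
  rewrite !inE => evx; apply/negP => /imsetP[y _ [xv _]].
  by rewrite xv ie in evx.
by congr (_ + _); rewrite big_imset //= => x y _ _ [].
Qed.

End NeighborhoodSums.

Section MagicGrid.

Import GRing.Theory.
Local Open Scope ring_scope.

(** Periodic increments make [h (k + p) - h k] independent of [k], so all [r] blocks of length [p]
    contribute equally. *)
Lemma increments_periodic (A : zmodType) (h : nat -> A) (p r : nat) :
  (forall k, h (k + p).+1 - h (k + p)%N = h k.+1 - h k) ->
  h (r * p)%N = h 0%N + (h p - h 0%N) *+ r.
Proof.
move=> hp; have shift k : h (k + p)%N = h k + (h p - h 0%N).
  elim: k => [|k IH]; first by rewrite add0n addrC subrK.
  by rewrite addSn -[LHS](subrK (h (k + p)%N)) hp IH addrA subrK.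
elim: r => [|r IH]; first by rewrite mul0n addr0.
by rewrite mulSnr shift IH mulrSr -addrA.
Qed.

Variables (A : zmodType) (g : nat -> nat -> A) (mu : A).
Hypothesis magic : forall a b,
  g a.+2 b.+1 + g a b.+1 + (g a.+1 b.+2 + g a.+1 b) = mu.

Let d (a b : nat) := g a.+2 b.+2 - g a b.

Lemma increment_antidiagonal a b : d a.+1 b = - d a b.+1.
Proof.
have E := magic a b; rewrite -(magic a.+1 b.+1) in E.
rewrite /d opprB; apply/eqP; rewrite subr_eq addrAC eq_sym subr_eq; apply/eqP.
(* These are the two common neighbors of the centers [(a.+1, b.+1)] and [(a.+2, b.+2)]. *)
apply: (addIr (g a.+1 b.+2 + g a.+2 b.+1)).
rewrite [RHS]addrACA -E [g a b.+1 + _]addrC addrACA.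
by rewrite [g a.+2 _ + _]addrC addrC [g a.+1 b + _]addrC.
Qed.

(** Two antidiagonal steps cancel the sign; shifting both sides avoids subtraction in [nat]. *)
Lemma increment_shift a b k : d a (b + k.*2) = d (a + k.*2)%N b.
Proof.
elim: k a => [|k IH] a; first by rewrite !addn0.
rewrite doubleS !addnS -[LHS]opprK -increment_antidiagonal.
by rewrite -increment_antidiagonal IH !addSn.
Qed.

Lemma magic_grid_diagonal_period (m n p r : nat) :
  (forall a b, g (a + m)%N b = g a b) -> (forall a b, g a (b + n)%N = g a b) ->
  (m %| 4 * p)%N || (n %| 4 * p)%N -> (forall x : A, x *+ r = 0) ->
  g (2 * (r * p))%N (2 * (r * p))%N = g 0%N 0%N.
Proof.
move=> gm gn mn4p r0.
have gmk k a b : g (a + k * m)%N b = g a b.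
  by elim: k => [|k IH]; rewrite ?addn0 // mulSnr addnA gm.
have gnk k a b : g a (b + k * n)%N = g a b.
  by elim: k => [|k IH]; rewrite ?addn0 // mulSnr addnA gn.
have dp a b : d (a + p.*2)%N (b + p.*2)%N = d a b.
  case/orP: mn4p => /dvdnP[k pE].
    rewrite increment_shift -addnA addnn -!muln2 -mulnA mulnC pE.
    by rewrite /d -!addSn !gmk.
  rewrite -increment_shift -addnA addnn -!muln2 -mulnA mulnC pE.
  by rewrite /d -!addSn !gnk.
(* As [d] jumps by 2, the diagonal is sampled at even points, where the period [2p] becomes [p]. *)
have /(_ p r) := @increments_periodic A (fun k => g k.*2 k.*2).
rewrite r0 addr0 -mul2n; apply=> k.
by rewrite !doubleS doubleD; apply: dp.
Qed.

End MagicGrid.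

(** In closed form [f m] is [m / gcd(m, 4)]. *)
Lemma dvdn_4f m : m %| 4 * f m.
Proof.
rewrite /f; case: eqP => [m4|_]; first by have -> : 4 * (m %/ 4) = m by lia.
case: eqP => [m4|_]; last exact: dvdn_mull.
have -> : 4 * (m %/ 2) = 2 * m by lia.
exact: dvdn_mull.
Qed.

Lemma f_gt0 m : 0 < m -> 0 < f m.
Proof. by rewrite /f => m0; case: eqP => ?; [|case: eqP => ?]; lia. Qed.

Theorem theorem3p1 (m n : nat) (hm : 3 <= m) (hn : 3 <= n)
    (hmn : ~~ odd (m * n)) (Gamma : finZmodType) (hGamma : #|Gamma| = m * n)
    (r : nat) (hr : r = exponent [set: Gamma])
    (hlt : 2 * r * minn (f m) (f n) < lcmn m n) :
  ~ exists l : 'I_m * 'I_n -> Gamma,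
      distance_magic_labeling
        (cartesian_product (@cycle_graph m) (@cycle_graph n)) l.
Proof.
case=> l [/bij_inj l_inj [mu l_magic]].
have [r_gt0 r0 _] := (exponent_additiveP Gamma r).1 hr.
have m0 : 0 < m by apply: leq_trans hm.
have n0 : 0 < n by apply: leq_trans hn.
pose im a := Ordinal (ltn_pmod a m0); pose jn b := Ordinal (ltn_pmod b n0).
have imS a : ordS (im a) = im a.+1.
  by apply: val_inj; rewrite /= -addn1 modnDml addn1.
have jnS b : ordS (jn b) = jn b.+1.
  by apply: val_inj; rewrite /= -addn1 modnDml addn1.
have imP a : ord_pred (im a.+1) = im a by rewrite -imS ordSK.
have jnP b : ord_pred (jn b.+1) = jn b by rewrite -jnS ordSK.
(* Centers are taken at [(a.+1, b.+1)] below, so no predecessor of 0 arises in [nat]. *)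
pose g a b := l (im a, jn b).
have g_magic a b :
    (g a.+2 b.+1 + g a b.+1 + (g a.+1 b.+2 + g a.+1 b))%R = mu.
  rewrite -(l_magic (im a.+1, jn b.+1)) sum_cartesian_product_neighborhood.
    by rewrite !sum_cycle_neighborhood // !imS !jnS imP jnP.
  by case: (cycle_graph_simple hm).
set p := minn (f m) (f n) in hlt.
have p_dvd : (m %| 4 * p) || (n %| 4 * p).
  by rewrite /p; case: leqP; rewrite dvdn_4f ?orbT.
have gm a b : g (a + m) b = g a b.
  by congr (l (_, _)); apply: val_inj; rewrite /= modnDr.
have gn a b : g a (b + n) = g a b.
  by congr (l (_, _)); apply: val_inj; rewrite /= modnDr.
have := magic_grid_diagonal_period _ _ _ g_magic _ _ _ _ gm gn p_dvd r0.
move/l_inj=> [/eqP]; rewrite mod0n => mdvd /eqP; rewrite mod0n => ndvd.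
have /dvdn_leq : lcmn m n %| 2 * (r * p) by rewrite dvdn_lcm /dvdn mdvd ndvd.
(* Divisibility bounds the lcm only because [2rp] is nonzero. *)
have p_gt0 : 0 < p by rewrite leq_min !f_gt0.
by rewrite !muln_gt0 r_gt0 p_gt0 mulnA => /(_ isT); rewrite leqNgt hlt.
Qed.
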